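(* Let $\varepsilon\in(0,\frac19)$, $t\ge2$ an integer, let $\mathcal F=(F=([n],E),r,(C_1,\dots,C_T),(c_1,\dots,c_T))$ be a $(t,\varepsilon)$-estimation-forest for an MNL $M$ on $[n]$, and let $\hat M$ be the MNL returned by $\mathrm{GenerateWeights}(\mathcal F)$. Then $d_1(M,\hat M)\le9\varepsilon$.
   Context: An MNL $M$ on $[n]$ has weights $w_1,\dots,w_n>0$ and $M_S(i)=w_i/\sum_{j\in S}w_j$ for non-empty $S\subseteq[n]$; $d_1(M,M')=\max_{\emptyset\ne S}\|M_S-M'_S\|_1$. An ordered clustering is an ordered partition $(C_1,\dots,C_T)$ of $[n]$ with centers $c_i\in C_i$; $\gamma(v)$ denotes the index with $v\in C_{\gamma(v)}$. For an undirected forest $F=([n],E)$, $P(u,v)$ is the unique path from $u$ to $v$ (when in the same component) and $d(u,v)$ the number of edges on it, with $d(u,v)=\infty$ if $u,v$ are in different components. A directed weighting is $r:\{(u,v):\{u,v\}\in E\}\to\mathbb{R}_{>0}$ with $r(u,v)=1/r(v,u)$; for a path $u_1,\dots,u_k$, $r(P)=\prod_{i=1}^{k-1}r(u_i,u_{i+1})$ (and $r(P)=1$ if $k=1$). A $(t,\varepsilon)$-estimation-forest for $M$ is such a tuple $(F,r,(C_i),(c_i))$ such that for all $u,v\in[n]$ with $\gamma(u)\ge\gamma(v)$: (1) if $d(u,v)\le t$ then $r(P(u,v))\in[(1-\varepsilon)\frac{w_u}{w_v},(1+\varepsilon)\frac{w_u}{w_v}]$ and $r(P(v,u))\in[(1-\varepsilon)\frac{w_v}{w_u},(1+\varepsilon)\frac{w_v}{w_u}]$;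 (2) if $t<d(u,v)<\infty$ then $\sum_{s\in[n],\gamma(s)\le\gamma(v)}\frac{w_s}{w_u}\le\varepsilon$ and $\sum_{s\in\mathcal C,\gamma(s)\le\gamma(v)}r(P(s,u))\le\varepsilon$, where $\mathcal C$ is the connected component containing $u$ and $v$; (3) if $d(u,v)=\infty$ then $\sum_{s\in[n],\gamma(s)\le\gamma(v)}\frac{w_s}{w_u}\le\varepsilon$, and moreover $\gamma(u')>\gamma(v')$ for every $u'$ in the component of $u$ and $v'$ in the component of $v$; (4) if $\gamma(u)=\gamma(v)$ then $d(u,v)\le t$. $\mathrm{GenerateWeights}(\mathcal F)$: initialize all $\hat w_i$ as unassigned and $w_{\min}=1$. For $c=c_T,c_{T-1},\dots,c_1$ in this order: if $\hat w_c$ is unassigned, let $W$ be the vertex set of the tree of $F$ containing $c$, set $\hat w_u=r(P(u,c))$ for all $u\in W$ (so $\hat w_c=1$), let $\Upsilon=\max_{j\in W}\hat w_j$; if $c\ne c_T$, replace $\hat w_j$ by $\hat w_j\cdot\frac{\varepsilon}{\Upsilon n}\cdot w_{\min}$ for all $j\in W$; then set $w_{\min}=\min\{w_{\min},\min_{j\in W}\hat w_j\}$. Output the MNL $\hat M$ with weights $\hat w_1,\dots,\hat w_n$. *)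

(* Defs.v *)
From HB Require Import structures.
From mathcomp Require Import all_boot all_order all_algebra.
Set Implicit Arguments.
Unset Strict Implicit.
Unset Printing Implicit Defensive.
Import Order.TTheory GRing.Theory Num.Theory.
Local Open Scope ring_scope.

Record mnl (R : realFieldType) (n : nat) := Mnl {
  weight :> 'I_n -> R;
  weight_gt0 : forall i, 0 < weight i
}.

Section Mnl.
Variables (R : realFieldType) (n : nat).
Implicit Types (M : mnl R n) (S : {set 'I_n}).

(* M_S(i); meaningful for i \in S *)
Definition choice_prob M S (i : 'I_n) : R := M i / \sum_(j in S) M j.

(* The default 0 of the maximum is harmless, the l1 norms being nonnegative. *)
Definition d1 M M' : R :=
  \big[Num.max/0]_(S : {set 'I_n} | S != set0)
    \sum_(i in S) `|choice_prob M S i - choice_prob M' S i|.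

End Mnl.

Section Paths.
Variables (n : nat) (e : rel 'I_n).

Definition simple_path (u v : 'I_n) (p : seq 'I_n) : bool :=
  [&& path e u p, last u p == v & uniq (u :: p)].

(* The vertex sequence u = u_1, ..., u_k = v of a simple path from u to v (the
   unique one in a forest), or [::] if v is not reachable from u. Simple paths
   have at most n vertices, so searching among bounded sequences is enough. *)
Definition tree_path (u v : 'I_n) : seq 'I_n :=
  if [pick p : n.-bseq 'I_n | simple_path u v p] is Some p then u :: p
  else [::].

(* Number of edges of the path from u to v; meaningful only if connect e u v.
   The distance is infinite exactly when ~~ connect e u v. *)
Definition path_length (u v : 'I_n) : nat := (size (tree_path u v)).-1.

Definition dist_le (t : nat) (u v : 'I_n) : bool :=
  connect e u v && (path_length u v <= t)%N.

Definition dist_gt_fin (t : nat) (u v : 'I_n) : bool :=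
  connect e u v && (t < path_length u v)%N.

Definition dist_infty (u v : 'I_n) : bool := ~~ connect e u v.

Definition component (u : 'I_n) : {set 'I_n} := [set s | connect e u s].

Definition acyclic : Prop :=
  forall s : seq 'I_n, (2 < size s)%N -> ~ ucycle e s.

End Paths.

(* A forest on 'I_n with a directed weighting r and an ordered clustering with
   centers. The ordered partition (C_1, ..., C_T) is given by its index map
   gamma, C_i being the fibre of gamma over i; cluster indices are 0-based, and
   the centers witness that all fibres are nonempty. The values of r on pairs
   that are not edges are irrelevant. *)
Record clustered_forest (R : realFieldType) (n : nat) := ClusteredForest {
  edge : rel 'I_n;
  edge_sym : symmetric edge;
  edge_irr : irreflexive edge;
  edge_acyclic : acyclic edge;
  wratio : 'I_n -> 'I_n -> R;
  wratio_gt0 : forall u v, edge u v -> 0 < wratio u v;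
  wratioV : forall u v, edge u v -> wratio u v = (wratio v u)^-1;
  nclusters : nat;
  gamma : 'I_n -> 'I_nclusters;
  center : 'I_nclusters -> 'I_n;
  gamma_center : forall i, gamma (center i) = i
}.
Arguments center {R n} F i : rename.

Section EstimationForest.
Variables (R : realFieldType) (n : nat).
Implicit Types (M : mnl R n) (F : clustered_forest R n).

Definition seq_ratio F (s : seq 'I_n) : R :=
  \prod_(x <- zip s (behead s)) wratio F x.1 x.2.

(* r(P(u, v)) *)
Definition path_ratio F (u v : 'I_n) : R := seq_ratio F (tree_path (edge F) u v).

Record estimation_forest (t : nat) (eps : R) M F : Prop := EstimationForest {
  ef_near : forall u v, (gamma F v <= gamma F u)%N ->
    dist_le (edge F) t u v ->
    [/\ (1 - eps) * (M u / M v) <= path_ratio F u v <= (1 + eps) * (M u / M v)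
      & (1 - eps) * (M v / M u) <= path_ratio F v u <= (1 + eps) * (M v / M u)];
  ef_far : forall u v, (gamma F v <= gamma F u)%N ->
    dist_gt_fin (edge F) t u v ->
    \sum_(s | (gamma F s <= gamma F v)%N) M s / M u <= eps /\
    \sum_(s in component (edge F) u | (gamma F s <= gamma F v)%N)
      path_ratio F s u <= eps;
  ef_infty : forall u v, (gamma F v <= gamma F u)%N ->
    dist_infty (edge F) u v ->
    \sum_(s | (gamma F s <= gamma F v)%N) M s / M u <= eps /\
    {in component (edge F) u & component (edge F) v,
      forall u' v', (gamma F v' < gamma F u')%N};
  ef_cluster : forall u v, gamma F u = gamma F v -> dist_le (edge F) t u v
}.

(* The state consists of the current weights (None: unassigned) and w_min. *)
Definition generate_step (eps : R) F
    (st : ('I_n -> option R) * R) (i : 'I_(nclusters F)) :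
    ('I_n -> option R) * R :=
  let: (w, wmin) := st in
  let c := center F i in
  if w c is Some _ then st else
  let W := component (edge F) c in
  let w0 := fun u => path_ratio F u c in
  let Upsilon := \big[Num.max/0]_(j in W) w0 j in
  let w1 := if i.+1 == nclusters F then w0
            else fun j => w0 j * (eps / (Upsilon * n%:R)) * wmin in
  (fun j => if j \in W then Some (w1 j) else w j,
   \big[Num.min/wmin]_(j in W) w1 j).

Definition generate_weights (eps : R) F : 'I_n -> option R :=
  (foldl (@generate_step eps F) (fun=> None, 1) (rev (enum 'I_(nclusters F)))).1.

(* All weights end up assigned, and M' is the MNL they define. *)
Definition generates (eps : R) F (M' : mnl R n) : Prop :=
  forall i, generate_weights eps F i = Some (M' i).

End EstimationForest.

(* Main.v *)
(* Fix a menu S and let u be an item of S whose cluster has the largest index.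
   Items of S at distance at most t from u have nearly the right weight relative
   to u: this is condition (1), since in a forest r(P(v,u)) is the ratio of the
   generated weights of v and u within a tree. By (2) and (3) the other items of
   S weigh at most eps * w_u in M. In the generated MNL, those in the tree of u
   weigh at most eps times the weight of u by (2), and those in other trees too:
   by (3) these trees are treated later, and so are scaled down to at most
   eps / n times the weight of u. Rescaling so that the weights of u agree, the
   two weight vectors are at l1-distance at most 4 eps M(S) on S, and normalizing
   at most doubles this. *)
Require Import Defs.
From HB Require Import structures.
From mathcomp Require Import all_boot all_order all_algebra.
From mathcomp Require Import zify ring lra.
Import Order.TTheory GRing.Theory Num.Theory.
Local Open Scope ring_scope.

Set Implicit Arguments.
Unset Strict Implicit.
Unset Printing Implicit Defensive.

(** * Multiplicativity of $r$ along walks in a forest *)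

Lemma not_uniq_split (T : eqType) (s : seq T) : ~~ uniq s ->
  exists x s1 s2 s3, s = rcons s1 x ++ rcons s2 x ++ s3.
Proof.
elim: s => //= y s IHs; rewrite negb_and negbK.
have [/path.splitP[s1 s2] _ | _ /= /IHs [x [s1 [s2 [s3 ->]]]]] := boolP (y \in s).
  by exists y, [::], s1, s2.
by exists x, (y :: s1), s2, s3.
Qed.

Section WalkRatio.
Variables (R : realFieldType) (n : nat) (F : clustered_forest R n).
Implicit Types (u v x : 'I_n) (p q : seq 'I_n).
Local Notation e := (edge F).

Lemma seq_ratio1 u : seq_ratio F [:: u] = 1.
Proof. by rewrite /seq_ratio /= big_nil. Qed.

Lemma seq_ratio_cons u v p :
  seq_ratio F [:: u, v & p] = wratio F u v * seq_ratio F (v :: p).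
Proof. by rewrite /seq_ratio /= big_cons. Qed.

Lemma seq_ratio_cat u p q :
  seq_ratio F (u :: p ++ q) = seq_ratio F (u :: p) * seq_ratio F (last u p :: q).
Proof.
elim: p u => [|v p IHp] u /=; first by rewrite seq_ratio1 mul1r.
by rewrite !seq_ratio_cons IHp mulrA.
Qed.

Lemma seq_ratio_gt0 u p : path e u p -> 0 < seq_ratio F (u :: p).
Proof.
elim: p u => [|v p IHp] u /=; first by rewrite seq_ratio1.
by case/andP=> uv /IHp; rewrite seq_ratio_cons; apply/mulr_gt0/wratio_gt0.
Qed.

Lemma wratio_mulV u v : e u v -> wratio F u v * wratio F v u = 1.
Proof.
move=> uv; rewrite (wratioV uv) mulVf // lt0r_neq0 //.
by apply: wratio_gt0; rewrite edge_sym.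
Qed.

Lemma reverse_walk u p : path e u p -> exists q,
  [/\ path e (last u p) q, last (last u p) q = u
    & seq_ratio F (u :: p) * seq_ratio F (last u p :: q) = 1].
Proof.
elim: p u => [|v p IHp] u /=; first by exists [::]; rewrite seq_ratio1 mulr1.
case/andP=> uv /IHp [q [Pq lq rq]]; exists (rcons q u).
rewrite rcons_path Pq lq last_rcons edge_sym uv; split=> //.
rewrite -cats1 seq_ratio_cat lq !seq_ratio_cons seq_ratio1 mulr1.
by rewrite [_ * wratio F v u]mulrC mulrACA wratio_mulV // mul1r.
Qed.

(* A closed walk either visits a vertex twice, and then splits into two shorter
   closed walks, or it is a simple cycle, hence of length at most 2. *)
Lemma closed_walk_ratio u p :
  path e u p -> last u p = u -> seq_ratio F (u :: p) = 1.
Proof.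
have [m] := ubnP (size p); elim: m => // m IHm in u p *.
rewrite ltnS => le_p_m Pp lp.
have [Up | nUp] := boolP (uniq p).
  (* The walk ends at [u], so [p] by itself lists the vertices of the cycle. *)
  have Cp : ucycle e p by apply/andP; rewrite (cycle_path u) lp.
  case: p => [|v [|w [|? ?]]] in Pp lp Up Cp {le_p_m} *.
  - exact: seq_ratio1.
  - by move: Pp; rewrite /= -lp /= edge_irr.
  - rewrite !seq_ratio_cons seq_ratio1 mulr1 -lp /=.
    by move: Pp => /and3P[_ vw _]; rewrite mulrC wratio_mulV.
  by case: (@edge_acyclic _ _ F _ _ Cp).
have [x [p1 [p2 [p3 def_p]]]] : exists x (p1 p2 p3 : seq 'I_n),
    p = rcons p1 x ++ rcons p2 x ++ p3 by exact: not_uniq_split.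
move: Pp lp; rewrite def_p !cat_path !last_cat !last_rcons => /and3P[P1 P2 P3] l3.
have le_sz : ((size p1 + size p2 + size p3).+1 < m)%N.
  by move: le_p_m; rewrite def_p !size_cat !size_rcons; lia.
(* The inner loop [rcons p2 x] at [x] contributes 1; without it, [rcons p1 x ++ p3] is a shorter
   closed walk at [u]. *)
rewrite !seq_ratio_cat !last_rcons [X in _ * (X * _)]IHm ?last_rcons //; last first.
  by rewrite size_rcons; lia.
rewrite mul1r -[x in seq_ratio F (x :: p3)](last_rcons u p1) -seq_ratio_cat.
apply: IHm; rewrite ?cat_path ?P1 ?last_cat ?last_rcons // size_cat size_rcons.
lia.
Qed.

Lemma tree_path_walk u v : connect e u v -> exists p,
  [/\ path e u p, last u p = v & tree_path e u v = u :: p].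
Proof.
rewrite /tree_path; case: pickP => [p /and3P[Pp /eqP lp _] _ | no_p].
  by exists p.
case/connectP=> p0 /shortenP[p Pp Up _] def_v.
have le_p_n : (size p <= n)%N.
  apply: ltnW; rewrite -[X in (_ < X)%N](card_ord n).
  by move/card_uniqP: Up => /= <-; apply: max_card.
by have := no_p (Bseq le_p_n); rewrite /simple_path Pp -def_v eqxx Up.
Qed.

(** If [q] reverses [p], the chosen simple path followed by [q] is a closed walk, so its ratio and
    that of [p] are both inverse to the ratio of [q]. Hence any walk can stand in for the chosen
    path. *)
Lemma path_ratio_walk u p :
  path e u p -> path_ratio F u (last u p) = seq_ratio F (u :: p).
Proof.
move=> Pp; have [q [Pq lq rq]] := reverse_walk Pp.
have [|p' [Pp' lp' tp]] := @tree_path_walk u (last u p).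
  by apply/connectP; exists p.
have nz : seq_ratio F (last u p :: q) != 0 by rewrite lt0r_neq0 ?seq_ratio_gt0.
apply: (mulIf nz); rewrite rq /path_ratio tp -[in last u p :: q]lp' -seq_ratio_cat.
by apply: closed_walk_ratio; rewrite ?cat_path ?last_cat lp' ?Pp'.
Qed.

Lemma path_ratio_gt0 u v : connect e u v -> 0 < path_ratio F u v.
Proof. by case/connectP=> p Pp ->; rewrite path_ratio_walk ?seq_ratio_gt0. Qed.

Lemma path_ratioM u v x : connect e u v -> connect e v x ->
  path_ratio F u x = path_ratio F u v * path_ratio F v x.
Proof.
case/connectP=> p Pp -> /connectP[q Pq ->].
by rewrite !path_ratio_walk // -seq_ratio_cat -path_ratio_walk ?last_cat // cat_path Pp.
Qed.

End WalkRatio.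

(** * An invariant of GenerateWeights *)

Section GenerateWeights.
Variables (R : realFieldType) (n : nat) (F : clustered_forest R n) (eps : R).
Implicit Types (u v : 'I_n) (s : seq 'I_(nclusters F)).
Local Notation e := (edge F).
Local Notation state := (('I_n -> option R) * R)%type.

Lemma connect_edge_sym : connect_sym e.
Proof. exact/sym_connect_sym/edge_sym. Qed.

(** Here [s] lists the clusters treated so far. Besides the ratios, [inv_ratio] records that trees
    are assigned as a whole; the fields on $w_{\min}$ make the next scaling small against all
    earlier weights. *)
Record weights_inv s (st : state) : Prop := WeightsInv {
  inv_assigned u x : st.1 u = Some x ->
    exists2 j, j \in s & connect e (center F j) u;
  inv_center j : j \in s -> st.1 (center F j) != None;
  inv_wmin_gt0 : 0 < st.2;
  inv_wmin_le u x : st.1 u = Some x -> st.2 <= x;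
  inv_ratio u v x : st.1 u = Some x -> connect e u v ->
    exists2 y, st.1 v = Some y & x = path_ratio F u v * y;
  inv_separated u v x y : st.1 u = Some x -> st.1 v = Some y ->
    ~~ connect e u v -> (gamma F v <= gamma F u)%N -> y <= eps / n%:R * x
}.

Hypotheses (eps_gt0 : 0 < eps)
  (clusters_sep : forall u v u' v', (gamma F v <= gamma F u)%N ->
     ~~ connect e u v -> connect e u u' -> connect e v v' ->
     (gamma F v' < gamma F u')%N).

(** Multiplying a whole tree by one constant preserves the ratios within it, and the constant brings
    its weights down to at most $\varepsilon/n$ times $w_{\min}$, hence times every earlier
    weight. *)
Lemma generate_step_inv s (i : 'I_(nclusters F)) st :
  {in s, forall j : 'I_(nclusters F), (i < j)%N} -> weights_inv s st ->
  weights_inv (rcons s i) (@generate_step _ _ eps F st i).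
Proof.
case: st => w wmin lt_is [/= wA wC wmin0 wmin_le wR wS].
rewrite /generate_step; set c := center F i.
case def_wc: (w c) => [xc|].
  split=> //= [u x /wA[j js cj]|j].
    by exists j => //; rewrite mem_rcons inE js orbT.
  by rewrite mem_rcons inE => /predU1P[-> | /wC //]; rewrite def_wc.
set W := component e c; set Ups := \big[_/_]_(_ in W) _.
have inW u : (u \in W) = connect e c u by rewrite inE.
have Wc u : u \in W -> connect e u c by rewrite inW connect_edge_sym.
have n_gt0 : 0 < n%:R :> R by rewrite ltr0n (leq_ltn_trans _ (ltn_ord c)).
have w0_gt0 u : u \in W -> 0 < path_ratio F u c by move/Wc/path_ratio_gt0.
have cW : c \in W by rewrite inW.
have w0_le u : u \in W -> path_ratio F u c <= Ups.
  by move=> Wu; apply: (le_bigmax_cond _ (fun j => path_ratio F j c)).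
have Ups_gt0 : 0 < Ups by apply: lt_le_trans (w0_le c cW); apply: w0_gt0.
set w1 := if _ then _ else _.
have [K K_gt0 w1E] : exists2 K : R,
    0 < K & forall u, w1 u = path_ratio F u c * K.
  rewrite /w1; case: ifP => _; first by exists 1 => // u; rewrite mulr1.
  exists (eps / (Ups * n%:R) * wmin) => [|u]; last by rewrite !mulrA.
  by rewrite !mulr_gt0 ?invr_gt0 ?mulr_gt0.
have w1_gt0 u : u \in W -> 0 < w1 u by move=> Wu; rewrite w1E mulr_gt0 ?w0_gt0.
(* A vertex assigned earlier comes from a treated index [j > i], so [i] is not the last index and
   the scaling did take place. *)
have w1_le u v y : u \in W -> w v = Some y -> w1 u <= eps / n%:R * y.
  move=> Wu wv; have [j js _] := wA _ _ wv.
  have lt_iT : (i.+1 < nclusters F)%N by apply: leq_ltn_trans (ltn_ord j); apply: lt_is.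
  rewrite /w1 ltn_eqF //; apply: le_trans (_ : eps / n%:R * wmin <= _); last first.
    by rewrite ler_pM2l ?divr_gt0 ?(wmin_le v).
  have -> : path_ratio F u c * (eps / (Ups * n%:R)) =
      path_ratio F u c / Ups * (eps / n%:R).
    by rewrite invfM; ring.
  rewrite ler_pM2r // ler_piMl ?ler_pdivrMr ?mul1r ?w0_le //.
  by rewrite divr_ge0 ?ltW.
(* An assigned vertex of [W] would force [c] to be assigned as well. *)
have old_notW u x : w u = Some x -> u \notin W.
  move=> wu; apply/negP => /Wc uc; have [y] := wR _ _ _ wu uc.
  by rewrite def_wc.
split=> /=.
- move=> u x; case: ifP => [|_ /wA[j js cj]].
    by rewrite inW => cu _; exists i; rewrite // mem_rcons mem_head.
  by exists j => //; rewrite mem_rcons inE js orbT.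
- move=> j; rewrite mem_rcons inE; case: ifP => // nWj /predU1P[def_j | /wC //].
  by rewrite def_j cW in nWj.
- exact: lt_bigmin.
- move=> u x; case: ifP => [Wu [<-] | _ /wmin_le].
    exact: bigmin_le_cond.
  exact/le_trans/bigmin_le_id.
- move=> u v x; case: ifP => [Wu [<-] uv | nWu wu uv].
    have Wv : v \in W by rewrite inW (connect_trans _ uv) // -inW.
    rewrite Wv; exists (w1 v) => //.
    by rewrite !w1E mulrA -path_ratioM // Wc.
  have [y wv ->] := wR _ _ _ wu uv.
  by rewrite (negPf (old_notW _ _ wv)); exists y.
move=> u v x y; case: ifP => [Wu [<-] | nWu wu].
  case: ifP => [Wv _ | nWv wv nuv le_vu].
    by rewrite (connect_trans (Wc u Wu)) // -inW.
  (* A new [u] cannot lie in a cluster at least as high as that of an older [v] in another tree: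
     [clusters_sep] would put the center of index [j > i] in the tree of [v] below the center of
     index [i]. *)
  have [j js cj] := wA _ _ wv.
  have := clusters_sep le_vu nuv (Wc u Wu).
  move=> /(_ (center F j)); rewrite connect_edge_sym cj !gamma_center => /(_ isT).
  by rewrite ltnNge ltnW ?lt_is.
by case: ifP => [Wv [<-] _ _ | nWv wv]; [apply: w1_le Wv wu | apply: wS].
Qed.

Lemma generate_weights_inv s : pairwise (fun j i : 'I__ => (i < j)%N) s ->
  weights_inv s (foldl (@generate_step _ _ eps F) (fun=> None, 1) s).
Proof.
elim/last_ind: s => [_ | s i IHs]; first by split=> //=.
rewrite pairwise_rcons -cats1 foldl_cat cats1 => /andP[/allP lt_is /IHs].
exact: generate_step_inv.
Qed.

Lemma generate_weightsP :
  (forall u v, gamma F u = gamma F v -> connect e u v) ->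
  exists Mhat : mnl R n,
  [/\ generates eps F Mhat,
      forall u v, connect e u v -> Mhat u = path_ratio F u v * Mhat v
    & forall u v, ~~ connect e u v -> (gamma F v <= gamma F u)%N ->
        Mhat v <= eps / n%:R * Mhat u].
Proof.
move=> cluster_conn; have [|wA wC wmin0 wmin_le wR wS] := @generate_weights_inv (rev (enum 'I_(nclusters F))).
  have := iota_ltn_sorted 0 (nclusters F).
  rewrite -val_enum_ord sorted_map -rev_sorted (sorted_pairwise) //.
  by move=> j i k /= ij jk; apply: ltn_trans jk ij.
(* Each vertex shares a tree with the center of its own cluster, and that center is assigned in the
   end. *)
have wT u : {x | generate_weights eps F u = Some x}.
  case def_w: (generate_weights eps F u) => [x|]; first by exists x.
  have /wC: gamma F u \in rev (enum 'I_(nclusters F)) by rewrite mem_rev mem_enum.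
  case def_c: (_.1 _) => [x|//] _; exfalso.
  have [y] := wR _ u _ def_c (cluster_conn _ _ (gamma_center _)).
  by rewrite -/(generate_weights eps F) def_w.
(* The final $w_{\min}$ is a positive lower bound for all weights. *)
have w_gt0 u : 0 < sval (wT u).
  by case: (wT u) => x /= wx; apply: lt_le_trans wmin0 (wmin_le _ _ wx).
exists (Mnl w_gt0); split=> [u|u v uv|u v nuv le_vu] /=; first by case: (wT u).
  case: (wT u) (wT v) => x wx [y wy] /=; have [y'] := wR _ _ _ wx uv.
  by rewrite -/(generate_weights eps F) wy => -[<-].
by case: (wT u) (wT v) => x wx [y wy] /=; apply: wS wx wy nuv le_vu.
Qed.

End GenerateWeights.

(** * From weight vectors to choice probabilities *)

Section L1Distance.
Variables (R : realFieldType) (n : nat).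

(** Scaling $M'$ by $k$ leaves its choice probabilities unchanged. With totals $X$, $Y$ of $M$ and
    $kM'$ on $S$, $|a/X-b/Y|\le|a-b|/X+b|X-Y|/(XY)$. The last terms sum to $|X-Y|/X$, which is again
    at most the $\ell_1$-distance divided by $X$. *)
Lemma choice_prob_dist_le (M M' : mnl R n) (S : {set 'I_n}) (k : R) :
  S != set0 -> 0 < k ->
  \sum_(i in S) `|choice_prob M S i - choice_prob M' S i| <=
    2%:R * (\sum_(i in S) `|M i - k * M' i|) / \sum_(i in S) M i.
Proof.
case/set0Pn=> s0 s0S k_gt0; set X := \sum_(i in S) M i.
have sum_gt0 (N : mnl R n) : 0 < \sum_(i in S) N i.
  rewrite (bigD1 s0) //= ltr_pwDl ?weight_gt0 // sumr_ge0 // => i _.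
  exact/ltW/weight_gt0.
have X_gt0 : 0 < X by exact: sum_gt0.
set Y := \sum_(i in S) k * M' i.
have Y_gt0 : 0 < Y by rewrite /Y -mulr_sumr mulr_gt0.
have M'E i : choice_prob M' S i = k * M' i / Y.
  by rewrite /choice_prob /Y -mulr_sumr -mulf_div divff ?mul1r ?gt_eqF.
have normE i : `|choice_prob M S i - choice_prob M' S i| <=
    `|M i - k * M' i| / X + k * M' i * (`|X - Y| / (X * Y)).
  have -> : choice_prob M S i - choice_prob M' S i =
      (M i - k * M' i) / X + k * M' i * ((Y - X) / (X * Y)).
    by rewrite M'E /choice_prob -/X; field; rewrite !gt_eqF.
  apply: le_trans (ler_normD _ _) _; rewrite !normrM !normfV [`|Y - X|]distrC.
  rewrite (gtr0_norm X_gt0) (gtr0_norm k_gt0) (gtr0_norm (mulr_gt0 X_gt0 Y_gt0)).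
  by rewrite (gtr0_norm (weight_gt0 M' i)).
apply: le_trans (ler_sum _ (fun i _ => normE i)) _.
rewrite big_split /= -!mulr_suml -/Y ler_pdivlMr // mulrDl divfK ?gt_eqF //.
have -> : Y * (`|X - Y| / (X * Y)) * X = `|X - Y|.
  by field; rewrite !gt_eqF.
rewrite mulr_natl mulr2n lerD2l /X /Y -sumrB.
exact: ler_norm_sum.
Qed.

End L1Distance.

(** Conditions (2) and (3) bound sums over all clusters up to that of one item. Taken at an item of
    [B] with maximal [g], such a sum covers all of [B]. *)
Lemma sum_le_of_max (R : realFieldType) (I : finType) (g : I -> nat) (f : I -> R)
    (Q : pred I) (B : {set I}) (b : R) : 0 <= b ->
  (forall i, Q i -> 0 <= f i) -> {in B, forall i, Q i} ->
  {in B, forall v, \sum_(i | Q i && (g i <= g v)%N) f i <= b} ->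
  \sum_(i in B) f i <= b.
Proof.
move=> b_ge0 f_ge0 BQ le_b; have [-> | [v0 v0B]] := set_0Vmem B.
  by rewrite big_set0.
case: (arg_maxnP g v0B) => v vB max_v; apply: le_trans (le_b v vB).
rewrite [leRHS](bigID [in B]) /= -[leLHS]addr0 lerD ?sumr_ge0 //.
  rewrite le_eqVlt; apply/predU1l/eq_bigl => i.
  by have [iB | _] := boolP (i \in B); rewrite ?andbF // BQ // andbT; apply/esym/max_v.
by move=> i /andP[/andP[/f_ge0]].
Qed.

(** * The error bound on a fixed menu *)

Theorem theorem6p13 (R : realFieldType) (n : nat) (eps : R) (t : nat)
    (M : mnl R n) (F : clustered_forest R n)
    (eps_gt0 : 0 < eps) (eps_lt : eps < 1 / 9%:R) (t_ge2 : (2 <= t)%N)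
    (hF : estimation_forest t eps M F) :
  exists Mhat : mnl R n, generates eps F Mhat /\ d1 M Mhat <= 9%:R * eps.
Proof.
have sep u v u' v' : (gamma F v <= gamma F u)%N -> ~~ connect (edge F) u v ->
    connect (edge F) u u' -> connect (edge F) v v' -> (gamma F v' < gamma F u')%N.
  move=> le_vu nuv uu' vv'; have [_] := ef_infty hF le_vu nuv.
  by apply; rewrite inE.
have [|Mh [genMh ratioMh sepMh]] := generate_weightsP eps_gt0 sep.
  by move=> u v /(ef_cluster hF)/andP[].
exists Mh; split=> //; apply: bigmax_le => [|S nzS]; first by rewrite mulr_ge0 ?ltW.
have [s1 s1S] := set0Pn _ nzS.
case: (arg_maxnP (fun i => gamma F i : nat) s1S) => u uS max_u {s1 s1S}.
have [Mu Mhu] : 0 < M u /\ 0 < Mh u by rewrite !weight_gt0.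
(* This factor gives [k * Mh u = M u]. *)
pose k := M u / Mh u; have k_gt0 : 0 < k by rewrite divr_gt0.
pose near v := dist_le (edge F) t u v.
pose conn v := connect (edge F) u v.
have farP v : ~~ near v -> conn v -> dist_gt_fin (edge F) t u v.
  by move=> + cv; rewrite /near /dist_le /dist_gt_fin -/(conn v) cv ltnNge.
have le_near v : v \in S -> near v -> `|M v - k * Mh v| <= eps * M v.
  move=> vS nv; have [_ /andP[]] := ef_near hF (max_u v vS) nv.
  have cvu : connect (edge F) v u by rewrite connect_edge_sym; case/andP: nv.
  have -> : path_ratio F v u = k * Mh v / M u.
    by rewrite (ratioMh _ _ cvu) /k; field; rewrite !gt_eqF.
  rewrite !mulrA !ler_pM2r ?invr_gt0 // ler_distlC => lo hi.
  by apply/andP; split; lra.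
have sumM : \sum_(v in S | ~~ near v) M v <= eps * M u.
  rewrite -big_set /=.
  apply: (@sum_le_of_max _ _ (fun i => gamma F i : nat) _ xpredT) => //.
  - by rewrite mulr_ge0 ?ltW.
  - by move=> i _; rewrite ltW ?weight_gt0.
  move=> v; rewrite inE => /andP[vS fv].
  rewrite /= -ler_pdivrMr // mulr_suml.
  (* Within the tree of [u] condition (2) applies, outside it condition (3); both bound the true
     weights in the same way. *)
  have [cv | ncv] := boolP (conn v).
    by have [] := ef_far hF (max_u v vS) (farP v fv cv).
  by have [] := ef_infty hF (max_u v vS) ncv.
have sumMh_conn : \sum_(v in S | ~~ near v && conn v) Mh v <= eps * Mh u.
  rewrite -big_set /=.
  apply: (@sum_le_of_max _ _ (fun i => gamma F i : nat) _ [in component (edge F) u]).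
  - by rewrite mulr_ge0 ?ltW.
  - by move=> i _; rewrite ltW ?weight_gt0.
  - by move=> i; rewrite !inE => /and3P[].
  move=> v; rewrite inE => /and3P[vS fv cv].
  have [_] := ef_far hF (max_u v vS) (farP v fv cv).
  rewrite -(ler_pM2r Mhu) mulr_suml; apply: le_trans; apply: ler_sum => s.
  by rewrite inE connect_edge_sym => /andP[su _]; rewrite -ratioMh.
have sumMh_nconn : \sum_(v in S | ~~ conn v) Mh v <= eps * Mh u.
  have n_gt0 : 0 < n%:R :> R by rewrite ltr0n (leq_ltn_trans _ (ltn_ord u)).
  (* Padding the sum to all $n$ vertices cancels the factor $1/n$. *)
  rewrite big_mkcond; apply: le_trans (_ : \sum_(v < n) eps / n%:R * Mh u <= _).
    apply: ler_sum => v _; case: ifP => [/andP[vS ncv] | _].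
      exact: sepMh ncv (max_u v vS).
    by rewrite !mulr_ge0 ?invr_ge0 ?ltW.
  rewrite sumr_const card_ord -[leLHS]mulr_natl.
  by rewrite le_eqVlt; apply/predU1l; field; rewrite gt_eqF.
(* One $\varepsilon$ comes from the tree of [u], the other from the remaining trees. *)
have sumMh : k * (\sum_(v in S | ~~ near v) Mh v) <= 2%:R * (eps * M u).
  have -> : 2%:R * (eps * M u) = k * (eps * Mh u + eps * Mh u).
    by rewrite /k; field; rewrite gt_eqF.
  rewrite ler_pM2l // (bigID conn) /=; apply: lerD.
    by under eq_bigl do rewrite -andbA.
  (* A vertex outside the tree of [u] is never near. *)
  under eq_bigl => v.
    rewrite -andbA; have -> : ~~ near v && ~~ conn v = ~~ conn v; last by over.
    by rewrite -negb_or /near /dist_le -/(conn v); case: (conn v); rewrite ?orbT.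
  by [].
apply: le_trans (choice_prob_dist_le M Mh nzS k_gt0) _.
have M_ge0 v : 0 <= M v by rewrite ltW ?weight_gt0.
have le_MuX : M u <= \sum_(v in S) M v by rewrite (bigD1 u) //= lerDl sumr_ge0.
rewrite ler_pdivrMr; last exact: lt_le_trans le_MuX.
have sum_near : \sum_(v in S | near v) `|M v - k * Mh v| <= eps * \sum_(v in S) M v.
  rewrite mulr_sumr [leRHS](bigID near) /= -[leLHS]addr0 lerD //.
    by apply: ler_sum => v /andP[]; apply: le_near.
  by apply: sumr_ge0 => v _; rewrite mulr_ge0 ?ltW ?weight_gt0.
have sum_far : \sum_(v in S | ~~ near v) `|M v - k * Mh v| <=
    \sum_(v in S | ~~ near v) M v + k * \sum_(v in S | ~~ near v) Mh v.
  rewrite mulr_sumr -big_split /=; apply: ler_sum => v _.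
  apply: le_trans (ler_normB _ _) _.
  by rewrite (gtr0_norm (weight_gt0 M v)) gtr0_norm // mulr_gt0 ?weight_gt0.
(* Near items contribute $\varepsilon M(S)$ and far ones $\varepsilon w_u+2\varepsilon
   w_u\le3\varepsilon M(S)$; doubling gives $8\varepsilon M(S)$, and nonnegativity of $\varepsilon
   M(S)$ covers the step from 8 to 9. *)
have := ler_wpM2l (ltW eps_gt0) le_MuX.
have : 0 <= eps * \sum_(v in S) M v by rewrite mulr_ge0 ?sumr_ge0 ?ltW.
rewrite [X in 2%:R * X](bigID near) /=; lra.
Qed.
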